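(* Let $f$ be a real-valued function defined in a neighborhood of $0$ in $\mathbb{R}$, continuous at $0$, with $|f(0)|<1$. Let $t>0$ be any fixed constant such that $|f(0)|e^t<1$, and define $a:\Gamma\to\mathbb{R}_{>0}$ by $$a(\gamma)=t\left[N_h(\gamma)+N_v(\gamma)\right].$$ Then there exists $\epsilon_0>0$ such that, for all $\epsilon\in[-\epsilon_0,\epsilon_0]$, the circuit model on $\mathbb{Z}^2$ with weights $\mathbf{w}(\gamma)=\epsilon^{N_h(\gamma)}\alpha^{N_v(\gamma)}$, $\alpha=f(\epsilon)$, satisfies the Kotecký–Preiss criterion for the convergence of the cluster expansion with this $a$: for all $\gamma_\ast\in\Gamma$, $$\sum_{\gamma\in\Gamma}|\mathbf{w}(\gamma)|\,e^{a(\gamma)}\,|\delta(\gamma,\gamma_\ast)-1|\le a(\gamma_\ast).$$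
   Context: $\mathbb{Z}^2$ is the square lattice (undirected nearest-neighbor graph). A self-avoiding trail (SAT) on $\mathbb{Z}^2$ is a sequence $(v_0,e_1,v_1,\dots,e_n,v_n)$, $n\ge1$, of $n$ edges and $n+1$ vertices such that $e_i$ connects $v_{i-1}$ and $v_i$ for all $1\le i\le n$ and the edges $e_1,\dots,e_n$ are distinct. A circuit is a SAT whose endpoints coincide, $v_0=v_n$ (with $n\ge1$). $\Gamma$ denotes the set of all circuits on $\mathbb{Z}^2$. For a circuit $\gamma$, $N_h(\gamma)$ and $N_v(\gamma)$ denote the numbers of horizontal and vertical edges in $\gamma$. Given $\alpha,\epsilon\in\mathbb{R}$, the weight of $\gamma$ is $\mathbf{w}(\gamma)=\epsilon^{N_h(\gamma)}\alpha^{N_v(\gamma)}$. The hard-core pair interaction $\delta(\gamma,\gamma')$ equals $0$ if $\gamma$ and $\gamma'$ share an edge and $1$ otherwise. The formal partition function of the circuit model is $\Xi=\sum_{\Gamma'\subseteq\Gamma}\prod_{\gamma\in\Gamma'}\mathbf{w}(\gamma)\prod_{\{\gamma,\gamma'\}\subseteq\Gamma'}\delta(\gamma,\gamma')$, adapted to finite volumes in the standard way. *)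

(* Defs.v *)
From mathcomp Require Import all_boot all_order all_algebra.
From mathcomp Require Import all_classical all_reals all_analysis.
Set Implicit Arguments.
Unset Strict Implicit.
Unset Printing Implicit Defensive.
Import Order.TTheory GRing.Theory Num.Theory.
Import numFieldNormedType.Exports.
Local Open Scope classical_set_scope.
Local Open Scope ring_scope.

Definition vertex : Type := (int * int)%type.

(* An undirected edge of Z^2 is encoded by its left (resp. lower) endpoint and
   a boolean telling whether it is horizontal; each edge has exactly one code. *)
Definition edge : Type := (vertex * bool)%type.

Definition horizontal (e : edge) : bool := e.2.

Definition edge_src (e : edge) : vertex := e.1.

Definition edge_tgt (e : edge) : vertex :=
  if horizontal e then (e.1.1 + 1, e.1.2) else (e.1.1, e.1.2 + 1).

Definition connects (e : edge) (u v : vertex) : bool :=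
  ((u == edge_src e) && (v == edge_tgt e))
  || ((u == edge_tgt e) && (v == edge_src e)).

(* (v0, [:: (e1, v1); ...; (en, vn)]) stands for (v0, e1, v1, ..., en, vn). *)
Definition edge_seq : Type := (vertex * seq (edge * vertex))%type.

Definition edges (g : edge_seq) : seq edge := [seq p.1 | p <- g.2].

Definition first_vertex (g : edge_seq) : vertex := g.1.

Definition last_vertex (g : edge_seq) : vertex :=
  last g.1 [seq p.2 | p <- g.2].

Fixpoint walk_from (u : vertex) (s : seq (edge * vertex)) : bool :=
  if s is (e, v) :: s' then connects e u v && walk_from v s' else true.

Definition self_avoiding_trail (g : edge_seq) : bool :=
  [&& (0 < size g.2)%N, walk_from g.1 g.2 & uniq (edges g)].

(* Circuits are sequences: different starting points or orientations of the
   same closed trail are different elements of Gamma. *)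
Definition Gamma : set edge_seq :=
  [set g | self_avoiding_trail g /\ first_vertex g = last_vertex g].

Definition N_h (g : edge_seq) : nat := count horizontal (edges g).
Definition N_v (g : edge_seq) : nat :=
  count (fun e => ~~ horizontal e) (edges g).

Definition weight (R : realType) (eps alpha : R) (g : edge_seq) : R :=
  eps ^+ N_h g * alpha ^+ N_v g.

Definition share_edge (g g' : edge_seq) : bool :=
  has (fun e => e \in edges g') (edges g).

Definition delta (R : realType) (g g' : edge_seq) : R :=
  if share_edge g g' then 0 else 1.

(* The Kotecky-Preiss criterion for a polymer set P with weights w, pair
   interaction d and size function a; the (possibly infinite) sum of
   nonnegative terms is taken in the extended reals. *)
Definition kotecky_preiss (R : realType) (T : choiceType) (P : set T)
    (w : T -> R) (d : T -> T -> R) (a : T -> R) : Prop :=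
  forall gs : T, P gs ->
    (\esum_(g in P) (`|w g| * expR (a g) * `|d g gs - 1|)%:E <= (a gs)%:E)%E.

Definition size_fun (R : realType) (t : R) (g : edge_seq) : R :=
  t * (N_h g + N_v g)%:R.

(* Main.v *)
Require Import Defs.
From mathcomp Require Import all_boot all_order all_algebra.
From mathcomp Require Import all_classical all_reals all_analysis.
From mathcomp Require Import ring lra zify.

(** Absorb the factor e^(a(g)) into the weights: the sum to be bounded becomes
    the sum of X^(N_h g) Y^(N_v g), with X = |eps| e^t and Y = |f eps| e^t,
    over the circuits g sharing an edge with a given circuit gs.  Near eps = 0,
    continuity keeps Y below a fixed y < 1, while X is arbitrarily small.

    The smallness comes from the horizontal edges: a closed trail cannot be
    made of vertical edges only ([circuit_N_h_gt0]).  Hence if X <= r x with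
    r <= 1, each circuit contributes at most r x^(N_h g) y^(N_v g)
    ([circuit_weight_le]), and it suffices that, for one fixed x > 0, the sum
    of x^(N_h g) y^(N_v g) over all trails g through a given edge is bounded
    by a constant C that does not depend on the edge: summing over the edges
    of gs ([sum_sharing_le]) then gives at most r C times the length of gs,
    which is at most a(gs) as soon as r C <= t.

    The trails through an edge e are obtained by letting two trails grow from
    the two ends of e, so that C is at most twice the square of the total weight
    of the trails leaving a vertex ([sum_trails_through_le]).  That total is
    finite for every y < 1 provided x is small, although there are two vertical
    directions and 2y may exceed 1: after a vertical step the trail cannot turn
    back along the same edge, so that, once its direction is chosen, a vertical
    run of length m contributes only y^m.
    This is a two-state transfer argument ([sum_trails_le]): a bounds the total
    weight of the continuations after a vertical step and b bounds it without
    that constraint, as soon as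
      1 + 2 x b + y a <= a   and   1 + 2 x b + 2 y a <= b.
    Both hold for a = 2 / (1 - y), b = 2 + 2 a and x = 1 / (2 b). *)

Set Implicit Arguments.
Unset Strict Implicit.
Unset Printing Implicit Defensive.
Import Order.TTheory GRing.Theory Num.Theory.
Import numFieldNormedType.Exports.
Local Open Scope classical_set_scope.
Local Open Scope ring_scope.

(** * Trails leaving a vertex *)

Lemma ler_sum_uniq_sub (R : numDomainType) (T : eqType) (s1 s2 : seq T)
    (F : T -> R) :
  (forall i, 0 <= F i) -> uniq s1 -> {subset s1 <= s2} ->
  \sum_(i <- s1) F i <= \sum_(i <- s2) F i.
Proof.
move=> F0; elim: s1 s2 => [|i s1 IH] s2 /=.
  by move=> _ _; rewrite big_nil; apply: sumr_ge0.
case/andP=> is1 us1 sub.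
have is2 : i \in s2 by apply: sub; rewrite mem_head.
rewrite big_cons (perm_big _ (perm_to_rem is2)) big_cons lerD2l.
apply: IH => // j js1.
have ji : j != i by apply: contraNneq is1 => <-.
have := sub j; rewrite in_cons js1 orbT => /(_ isT).
by rewrite (perm_mem (perm_to_rem is2)) in_cons (negbTE ji).
Qed.

Definition star (u : vertex) : seq (edge * vertex) :=
  [:: ((u, true), (u.1 + 1, u.2));
      (((u.1 - 1, u.2), true), (u.1 - 1, u.2));
      ((u, false), (u.1, u.2 + 1));
      (((u.1, u.2 - 1), false), (u.1, u.2 - 1))].

Lemma connects_star (e : edge) (u v : vertex) :
  connects e u v -> (e, v) \in star u.
Proof.
case: e => -[a b] h; case: u => u1 u2; case: v => v1 v2.
rewrite /connects /edge_src /edge_tgt /horizontal /star !inE /=.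
by case: h => /orP[] /andP[/eqP[-> ->] /eqP[-> ->]];
  rewrite /= ?addrK !eqxx ?orbT.
Qed.

Lemma connectsC (e : edge) (u v : vertex) : connects e u v = connects e v u.
Proof. by rewrite /connects orbC; congr (_ || _); rewrite andbC. Qed.

Lemma connects_ends (e : edge) (u v : vertex) : connects e u v ->
  (u, v) \in [:: (edge_src e, edge_tgt e); (edge_tgt e, edge_src e)].
Proof.
by rewrite /connects !inE => /orP[] /andP[/eqP-> /eqP->]; rewrite eqxx ?orbT.
Qed.

(** The list A of forbidden edges grows by the edge crossed at each step, so
    that a listed trail never turns back along the edge it has just crossed. *)
Fixpoint trails (n : nat) (A : seq edge) (u : vertex) :
    seq (seq (edge * vertex)) :=
  if n is n'.+1 then
    [::] :: flatten [seq [seq p :: s | s <- trails n' (p.1 :: A) p.2]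
                    | p <- star u & p.1 \notin A]
  else [:: [::]].

Lemma trailsS (n : nat) (A : seq edge) (u : vertex) :
  trails n.+1 A u =
  [::] :: flatten [seq [seq p :: s | s <- trails n (p.1 :: A) p.2]
                  | p <- star u & p.1 \notin A].
Proof. by []. Qed.

Lemma mem_trails (n : nat) (A : seq edge) (u : vertex)
    (s : seq (edge * vertex)) :
  (size s <= n)%N -> walk_from u s -> uniq [seq p.1 | p <- s] ->
  {in [seq p.1 | p <- s], forall e, e \notin A} -> s \in trails n A u.
Proof.
elim: n A u s => [|n IH] A u [|[e v] s] // sn.
case/andP=> euv wvs /andP[es us] sA; rewrite trailsS in_cons orFb.
apply/flattenP; exists [seq (e, v) :: s' | s' <- trails n (e :: A) v].
  apply/mapP; exists (e, v) => //; rewrite mem_filter connects_star // andbT.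
  exact/sA/mem_head.
apply: map_f; apply: IH => // f fs; rewrite in_cons negb_or.
rewrite sA ?in_cons ?fs ?orbT // andbT.
by apply: contraNneq es => <-.
Qed.

Definition walk_weight (R : realType) (x y : R) (s : seq (edge * vertex)) : R :=
  \prod_(p <- s) (if horizontal p.1 then x else y).

Lemma walk_weightE (R : realType) (x y : R) (g : edge_seq) :
  walk_weight x y g.2 = x ^+ N_h g * y ^+ N_v g.
Proof.
case: g => u s; rewrite /walk_weight /N_h /N_v /edges /=.
elim: s => [|p s IH] /=; first by rewrite big_nil mulr1.
rewrite big_cons IH; case: (horizontal p.1) => /=.
  by rewrite add1n add0n exprS mulrA.
by rewrite add1n add0n exprS mulrCA.
Qed.

Lemma walk_weight_ge0 (R : realType) (x y : R) (s : seq (edge * vertex)) :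
  0 <= x -> 0 <= y -> 0 <= walk_weight x y s.
Proof. by move=> x0 y0; apply: prodr_ge0 => p _; case: ifP. Qed.

Lemma sum_trailsS (R : realType) (x y : R) (n : nat) (A : seq edge)
    (u : vertex) :
  \sum_(s <- trails n.+1 A u) walk_weight x y s =
  1 + \sum_(p <- star u | p.1 \notin A) (if horizontal p.1 then x else y) *
        \sum_(s <- trails n (p.1 :: A) p.2) walk_weight x y s.
Proof.
rewrite trailsS big_cons /walk_weight big_nil; congr (1 + _).
rewrite big_flatten big_map big_filter; apply: eq_bigr => p _.
by rewrite big_map mulr_sumr; apply: eq_bigr => s _; rewrite big_cons.
Qed.

(** The bounds a and b form a supersolution of the recursion [sum_trailsS]: of
    the four edges at u, two are horizontal, with continuations bounded by b,
    and two are vertical, with continuations bounded by a because the edge just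
    crossed becomes forbidden.  If one of the vertical edges at u is already
    forbidden, only one vertical term remains. *)
Lemma sum_trails_le (R : realType) (x y a b : R) (n : nat) (A : seq edge)
    (u : vertex) :
  0 <= x -> 0 <= y -> 0 <= a -> 0 <= b ->
  1 + 2 * x * b + y * a <= a -> 1 + 2 * x * b + 2 * y * a <= b ->
  (forall e v, e \in A -> ~~ horizontal e -> connects e v u ->
    \sum_(s <- trails n A u) walk_weight x y s <= a) /\
  \sum_(s <- trails n A u) walk_weight x y s <= b.
Proof.
move=> x0 y0 a0 b0 va vb.
have ya0 : 0 <= y * a by apply: mulr_ge0.
have xb0 : 0 <= x * b by apply: mulr_ge0.
elim: n A u => [|n IH] A u.
  rewrite /= big_seq1 /walk_weight big_nil.
  by split=> [*|]; lra.
rewrite sum_trailsS /star !big_cons big_nil /=.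
set T := fun A' u' => \sum_(s <- trails n A' u') walk_weight x y s.
have hor A' u' : x * T A' u' <= x * b.
  by apply: ler_wpM2l => //; case: (IH A' u').
have ver A' e u' : ~~ horizontal e -> connects e u u' ->
    y * T (e :: A') u' <= y * a.
  move=> he ce; apply: ler_wpM2l => //.
  by have [H _] := IH (e :: A') u'; apply: (H e u) => //; rewrite mem_head.
have up : y * T ((u, false) :: A) (u.1, u.2 + 1) <= y * a.
  by apply: ver => //; rewrite /connects !eqxx.
have down : y * T ((u.1, u.2 - 1, false) :: A) (u.1, u.2 - 1) <= y * a.
  apply: ver => //.
  rewrite /connects /edge_src /edge_tgt /= subrK.
  by rewrite -surjective_pairing !eqxx orbT.
(* Each of the four terms is present or absent according to A; an absent term
   is bounded by the same nonnegative amount as a present one. *)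
have opt (c : bool) (z B r r' : R) : z <= B -> 0 <= B -> r <= r' ->
    (if c then z + r else r) <= B + r'.
  by case: c => zB B0 rr; lra.
split; last first.
  apply: le_trans vb; rewrite -addrA lerD2l.
  rewrite [leRHS](_ : _ = x * b + (x * b + (y * a + (y * a + 0)))); last by ring.
  apply: (opt _ _ _ _ _ (hor _ _) xb0).
  apply: (opt _ _ _ _ _ (hor _ _) xb0).
  apply: (opt _ _ _ _ _ up ya0).
  exact: (opt _ _ _ _ _ down ya0).
move=> f v fA hf; rewrite connectsC => /connects_star fu.
apply: le_trans va; rewrite -addrA lerD2l.
rewrite [leRHS](_ : _ = x * b + (x * b + (y * a + 0))); last by ring.
apply: (opt _ _ _ _ _ (hor _ _) xb0).
apply: (opt _ _ _ _ _ (hor _ _) xb0).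
move: fu; rewrite !inE => /or4P[] /eqP[ef _]; move: hf fA; rewrite ef // => _ ->.
  exact: (opt _ _ _ _ _ down ya0).
exact: (opt _ _ _ _ _ up ya0).
Qed.

(** * Trails through an edge *)

(** The walk that runs along q backwards, from the end of q to u, and then
    along s; q itself is read as a walk starting at u. *)
Fixpoint prepend (u : vertex) (q s : seq (edge * vertex)) : edge_seq :=
  if q is (f, v) :: q' then prepend v q' ((f, u) :: s) else (u, s).

Lemma prepend_rcons (u v : vertex) (f : edge) (q s : seq (edge * vertex)) :
  prepend u (rcons q (f, v)) s =
  (v, (f, (prepend u q s).1) :: (prepend u q s).2).
Proof. by elim: q u s => [|[e w] q IH] u s //=. Qed.

(** The starting vertex of [prepend u q s] is the end of q, whatever s is. *)
Lemma walk_from_rcons (u v : vertex) (f : edge) (q s : seq (edge * vertex)) :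
  walk_from u (rcons q (f, v)) =
  walk_from u q && connects f (prepend u q s).1 v.
Proof.
elim: q u s => [|[e w] q IH] u s /=; first by rewrite andbT.
by rewrite (IH _ ((e, u) :: s)) andbA.
Qed.

Lemma walk_weight_prepend (R : realType) (x y : R) (u : vertex)
    (q s : seq (edge * vertex)) :
  walk_weight x y (prepend u q s).2 = walk_weight x y q * walk_weight x y s.
Proof.
rewrite /walk_weight; elim: q u s => [|[e w] q IH] u s /=.
  by rewrite big_nil mul1r.
by rewrite IH !big_cons /= mulrCA mulrA.
Qed.

(** Reversing the part of a walk that precedes u gives a walk leaving u. *)
Lemma prepend_walk (v0 u : vertex) (s1 s : seq (edge * vertex)) :
  walk_from v0 s1 -> u = last v0 [seq p.2 | p <- s1] ->
  exists q, [/\ walk_from u q, prepend u q s = (v0, s1 ++ s) &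
               [seq p.1 | p <- q] = rev [seq p.1 | p <- s1]].
Proof.
elim: s1 v0 => [|[f v1] s1 IH] v0 /=; first by move=> _ ->; exists [::].
case/andP=> fv w1 /(IH _ w1)[q [wq pq eq]].
exists (rcons q (f, v0)); rewrite (walk_from_rcons _ _ _ _ s) prepend_rcons pq.
by rewrite wq connectsC fv map_rcons eq rev_cons.
Qed.

Lemma walk_from_cat (u : vertex) (s1 s2 : seq (edge * vertex)) :
  walk_from u (s1 ++ s2) =
  walk_from u s1 && walk_from (last u [seq p.2 | p <- s1]) s2.
Proof. by elim: s1 u => [|[e v] s1 IH] u //=; rewrite IH andbA. Qed.

(** The two pairs (u, v) are the two directions in which e can be crossed.
    Some of the listed sequences use an edge twice, once in each arm; this is
    harmless because the list only serves as an upper bound. *)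
Definition trails_through (n : nat) (e : edge) : seq edge_seq :=
  flatten [seq [seq prepend uv.1 q ((e, uv.2) :: s)
               | q <- trails n [::] uv.1, s <- trails n [::] uv.2]
          | uv <- [:: (edge_src e, edge_tgt e); (edge_tgt e, edge_src e)]].

Lemma mem_trails_through (n : nat) (e : edge) (g : edge_seq) :
  self_avoiding_trail g -> e \in edges g -> (size g.2 <= n)%N ->
  g \in trails_through n e.
Proof.
case: g => v0 s /and3P[/= _ + +] /mapP[[f v] fs /= ef]; rewrite -{}ef in fs *.
rewrite /edges /=; case/splitPr: s / fs => s1 s2.
rewrite walk_from_cat => /andP[w1 /= /andP[euv w2]].
rewrite map_cat cat_uniq /= => /and3P[us1 _ /andP[_ us2]].
rewrite size_cat /= => sn.
set u := last _ _ in euv *.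
have [q [wq pq eq]] := @prepend_walk v0 u s1 ((e, v) :: s2) w1 erefl.
apply/flattenP; eexists.
  by apply: (map_f _ (connects_ends euv)).
rewrite -pq; apply: allpairs_f => /=; apply: mem_trails => //.
- by rewrite -(size_map (@fst _ _)) eq size_rev size_map; lia.
- by rewrite eq rev_uniq.
- by lia.
Qed.

(** For each direction of e, the weight of a listed sequence is the product of
    the weights of e and of its two arms, so the sum factors into two sums
    bounded by b. *)
Lemma sum_trails_through_le (R : realType) (x y a b : R) (n : nat) (e : edge) :
  0 <= x <= 1 -> 0 <= y <= 1 -> 0 <= a -> 0 <= b ->
  1 + 2 * x * b + y * a <= a -> 1 + 2 * x * b + 2 * y * a <= b ->
  \sum_(g <- trails_through n e) walk_weight x y g.2 <= 2 * b ^+ 2.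
Proof.
move=> /andP[x0 x1] /andP[y0 y1] a0 b0 va vb.
have side u v : \sum_(g <- [seq prepend u q ((e, v) :: s)
      | q <- trails n [::] u, s <- trails n [::] v]) walk_weight x y g.2
      <= b ^+ 2.
  pose T w := \sum_(s <- trails n [::] w) walk_weight x y s.
  have T0 w : 0 <= T w by apply: sumr_ge0 => s _; apply: walk_weight_ge0.
  have Tb w : T w <= b by case: (@sum_trails_le R x y a b n [::] w).
  rewrite big_allpairs_dep.
  rewrite (_ : \sum_(q <- _) _ = (if horizontal e then x else y) * (T u * T v)).
    have TT : T u * T v <= b ^+ 2 by rewrite expr2; apply: ler_pM.
    have TT0 : 0 <= T u * T v by apply: mulr_ge0.
    by case: ifP => _; nra.
  rewrite /T mulr_suml mulr_sumr; apply: eq_bigr => q _.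
  rewrite mulr_sumr mulr_sumr; apply: eq_bigr => s _.
  by rewrite walk_weight_prepend [in LHS]/walk_weight [in LHS]big_cons mulrCA.
rewrite /trails_through /= cats0 big_cat /=.
by rewrite mulr_natl mulr2n; apply: lerD; apply: side.
Qed.

(** * Circuits have horizontal edges *)

(** A vertical walk stays in its column, where e is the only edge joining the
    vertices above the level of its lower end to the other ones. *)
Lemma vertical_walk_side (e : edge) (u : vertex) (s : seq (edge * vertex)) :
  ~~ horizontal e -> u.1 = e.1.1 -> walk_from u s ->
  {in [seq p.1 | p <- s], forall f, ~~ horizontal f && (f != e)} ->
  (e.1.2 < (last u [seq p.2 | p <- s]).2) = (e.1.2 < u.2).
Proof.
case: e => -[ex ey] [] //= _.
elim: s u => [|[f v] s IH] u //= ue /andP[fuv ws] sV.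
have /andP[fV fe] := sV f (mem_head _ _).
have sV' : {in [seq p.1 | p <- s],
    forall f0, ~~ horizontal f0 && (f0 != (ex, ey, false))}.
  by move=> h hs; apply: sV; rewrite in_cons hs orbT.
move: fV fe fuv; case: f {sV} => -[fx fy] [] //= _ fe.
rewrite /connects /edge_src /edge_tgt /=.
have fe' : fx = ex -> fy != ey.
  by move=> fx_ex; apply: contraNneq fe => ->; rewrite fx_ex.
by case/orP=> /andP[/eqP eu /eqP ev]; move: ue; rewrite eu /= => fxe;
  move: (fe' fxe) => {}fe'; rewrite IH // ev /=; lia.
Qed.

(** Otherwise, after crossing its first edge e, a circuit would have to return
    to the other side of e without using e again. *)
Lemma circuit_N_h_gt0 (g : edge_seq) : Gamma g -> (0 < N_h g)%N.
Proof.
case: g => v0 [|[e v1] s] [/and3P[//= _ /andP[ev ws] /andP[es _]]].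
rewrite /first_vertex /last_vertex /= => closed.
rewrite lt0n; apply/negP => /eqP H.
have allV f : f \in e :: [seq p.1 | p <- s] -> ~~ horizontal f.
  move=> fs; apply/negP => hf.
  have : has horizontal (edges (v0, (e, v1) :: s)) by apply/hasP; exists f.
  by rewrite has_count -/(N_h _) H.
have eV : ~~ horizontal e by apply: allV; rewrite mem_head.
have sV : {in [seq p.1 | p <- s], forall f, ~~ horizontal f && (f != e)}.
  move=> f fs; rewrite allV ?in_cons ?fs ?orbT //=.
  by apply: contraNneq es => <-.
have := @vertical_walk_side e v1 s eV _ ws sV; rewrite -closed.
move: ev eV; case: (e) => -[a b] [] //=.
rewrite /connects /edge_src /edge_tgt /=.
by case/orP=> /andP[/eqP-> /eqP->] _ /(_ erefl) /=; lia.
Qed.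

(** * The Kotecky-Preiss sum *)

(** One factor r is gained from a horizontal edge; the powers of r coming from
    the other horizontal edges are bounded by 1. *)
Lemma circuit_weight_le (R : realType) (x y X Y r : R) (g : edge_seq) :
  0 <= x -> 0 <= r <= 1 -> 0 <= X <= r * x -> 0 <= Y <= y -> Gamma g ->
  X ^+ N_h g * Y ^+ N_v g <= r * walk_weight x y g.2.
Proof.
move=> x0 /andP[r0 r1] /andP[X0 Xx] /andP[Y0 Yy] /circuit_N_h_gt0.
rewrite walk_weightE; case: (N_h g) => // h _; rewrite mulrA.
have lepow n : Y ^+ n <= y ^+ n.
  by apply: lerXn2r; rewrite ?nnegrE // (le_trans Y0).
apply: ler_pM; rewrite ?exprn_ge0 //.
apply: (@le_trans _ _ ((r * x) ^+ h.+1)).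
  by apply: lerXn2r => //; rewrite nnegrE mulr_ge0.
rewrite exprMn ler_wpM2r ?exprn_ge0 // exprS ler_piMr //.
exact: exprn_ile1.
Qed.

(** A union bound over the edges of gs. *)
Lemma sum_sharing_le (R : numDomainType) (F : edge_seq -> R) (C : R)
    (L : seq edge_seq) (gs : edge_seq) :
  (forall g, 0 <= F g) ->
  (forall e, \sum_(g <- L | e \in edges g) F g <= C) ->
  \sum_(g <- L | share_edge g gs) F g <= (size (edges gs))%:R * C.
Proof.
move=> F0 FC.
apply: (@le_trans _ _ (\sum_(e <- edges gs) \sum_(g <- L | e \in edges g) F g)).
  under [leRHS]eq_bigr do rewrite big_mkcond.
  rewrite exchange_big big_mkcond; apply: ler_sum => g _ /=.
  have pos e : 0 <= (if e \in edges g then F g else 0) by case: ifP.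
  case: ifP => [/hasP[e eg es]|_]; last by apply: sumr_ge0.
  by rewrite (perm_big _ (perm_to_rem es)) big_cons eg lerDl sumr_ge0.
apply: (le_trans (ler_sum _ (fun e _ => FC e))).
by rewrite big_const_seq count_predT iter_addr_0 mulr_natl.
Qed.

(** An infinite sum of nonnegative terms is the supremum of its finite subsums,
    so the criterion only has to be checked on finite families; their trails
    have bounded length, which is what the enumerations [trails] require. *)
Lemma finite_kotecky_preiss (R : realType) (x y a b r t eps alpha : R)
    (L : seq edge_seq) (gs : edge_seq) :
  0 <= x <= 1 -> 0 <= y <= 1 -> 0 <= a -> 0 <= b ->
  1 + 2 * x * b + y * a <= a -> 1 + 2 * x * b + 2 * y * a <= b ->
  0 <= r <= 1 -> r * (2 * b ^+ 2) <= t ->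
  `|eps| * expR t <= r * x -> `|alpha| * expR t <= y ->
  uniq L -> {in L, forall g, Gamma g} ->
  \sum_(g <- L) `|weight eps alpha g| * expR (size_fun t g)
     * `|delta R g gs - 1| <= size_fun t gs.
Proof.
move=> x01 y01 a0 b0 va vb r01 rt Xx Yy uL LG.
have [/andP[x0 _] /andP[y0 _] /andP[r0 _]] := And3 x01 y01 r01.
have E0 : 0 <= expR t := expR_ge0 t.
have size_gs : size_fun t gs = (size (edges gs))%:R * t.
  by rewrite /size_fun /N_h /N_v count_predC mulrC.
pose c (g : edge_seq) := walk_weight x y g.2.
have c0 g : 0 <= c g by apply: walk_weight_ge0.
have term g : g \in L ->
    `|weight eps alpha g| * expR (size_fun t g) * `|delta R g gs - 1|
    <= if share_edge g gs then r * c g else 0.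
  move=> gL; have Gg := LG _ gL; rewrite /delta; case: ifP => _; last first.
    by rewrite subrr normr0 mulr0.
  rewrite sub0r normrN normr1 mulr1 /size_fun natrD mulrDr expRD.
  rewrite !expRM_natr /weight normrM !normrX mulrACA -!exprMn.
  apply: circuit_weight_le => //.
  - by rewrite Xx mulr_ge0.
  - by rewrite Yy mulr_ge0.
rewrite big_seq; apply: (le_trans (ler_sum _ term)).
rewrite -big_seq -big_mkcond.
rewrite size_gs -mulr_sumr.
have share : \sum_(g <- L | share_edge g gs) c g <=
    (size (edges gs))%:R * (2 * b ^+ 2).
  apply: sum_sharing_le => // e.
  pose n := \max_(g <- L) size g.2.
  rewrite -big_filter.
  apply: (@le_trans _ _ (\sum_(g <- trails_through n e) c g)).
    apply: ler_sum_uniq_sub => //; first by rewrite filter_uniq.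
    move=> g; rewrite mem_filter => /andP[eg gL].
    apply: mem_trails_through => //; first by have [] := LG _ gL.
    by rewrite /n; apply: (leq_bigmax_seq _ gL).
  by apply: (@sum_trails_through_le _ _ _ a).
have n0 : 0 <= (size (edges gs))%:R :> R by [].
nra.
Qed.

Theorem proposition4p2 (R : realType) (D : set R) (f : R -> R)
  (hD : nbhs (0 : R) D)
  (f_cont : {for (0 : R), continuous f})
  (f0_lt1 : `|f 0| < 1)
  (t : R) (t_gt0 : 0 < t)
  (ht : `|f 0| * expR t < 1) :
  exists2 eps0 : R, 0 < eps0 &
    forall eps : R, - eps0 <= eps <= eps0 ->
      D eps /\
      kotecky_preiss Gamma (weight eps (f eps)) (@delta R) (size_fun t).
Proof.
have E0 : 0 < expR t := expR_gt0 t.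
have f0 : 0 <= `|f 0| * expR t by rewrite mulr_ge0 ?normr_ge0 ?ltW.
(* Any y strictly between |f 0| e^t and 1 would do. *)
pose y := (`|f 0| * expR t + 1) / 2.
have [y0 y1 fy] : [/\ 0 < y, y < 1 & `|f 0| * expR t < y].
  by rewrite /y; split; lra.
pose a := 2 / (1 - y); pose b := 2 + 2 * a; pose x := (2 * b)^-1.
have a0 : 0 < a by rewrite divr_gt0 // subr_gt0.
have b0 : 0 < b by rewrite /b; lra.
have x0 : 0 < x by rewrite invr_gt0 mulr_gt0.
have xb : 2 * x * b = 1 by rewrite /x; field; rewrite gt_eqF.
have ya : y * a = a - 2 by rewrite /a; field; rewrite subr_eq0 gt_eqF.
have x1 : x <= 1 by rewrite /x invf_le1 ?mulr_gt0 // /b; lra.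
pose r := Num.min 1 (t / (2 * b ^+ 2)).
have C0 : 0 < 2 * b ^+ 2 by rewrite mulr_gt0 ?exprn_gt0.
have r0 : 0 < r by rewrite lt_min ltr01 divr_gt0.
have r1 : r <= 1 by rewrite ge_min lexx.
have rt : r * (2 * b ^+ 2) <= t by rewrite -ler_pdivlMr // ge_min lexx orbT.
have : \forall eps \near (0 : R),
    [/\ D eps, `|f eps| * expR t <= y & `|eps| * expR t <= r * x].
  near=> eps; split.
  - by near: eps.
  - rewrite ltW // -ltr_pdivlMr //; near: eps.
    apply: (cvgr_norm_lt (f 0)) => //.
    by rewrite ltr_pdivlMr.
  - rewrite -ler_pdivlMr //; near: eps.
    apply: (@nbhs0_le R R^o).
    by rewrite divr_gt0 ?mulr_gt0.
case/nbhs_ballP=> d /= d0 Hd.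
exists (d / 2); first by rewrite divr_gt0.
move=> eps epsd.
have {Hd} [Deps Yy Xx] : [/\ D eps, `|f eps| * expR t <= y &
    `|eps| * expR t <= r * x].
  apply: Hd; rewrite /ball /= sub0r normrN.
  apply: (@le_lt_trans _ _ (d / 2)); first by rewrite ler_norml.
  by rewrite ltr_pdivrMr // ltr_pMr // ltr1n.
split=> // gs Ggs.
apply: ge_ereal_sup => _ [F [Ffin FG] <-].
rewrite fsbig_finite //= sumEFin lee_fin.
apply: (@finite_kotecky_preiss _ x y a b r) => //.
- by rewrite ltW.
- by rewrite !ltW.
- exact: ltW.
- exact: ltW.
- by rewrite xb ya; lra.
- by rewrite xb -mulrA ya /b; lra.
- by rewrite ltW.
- exact: finmap.fset_uniq.
- by move=> g; rewrite in_fset_set // inE => /FG.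
Unshelve. all: by end_near.
Qed.
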